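(* Let $(X,\Sigma)$ be a countably generated measurable space, let $\rho$ be a probability measure on $(X,\Sigma)$, let $\mathcal{G}$ be a sub-$\sigma$-algebra of $\Sigma$, and suppose that $\rho^{\mathcal{G}}:X\to\mathcal{P}$ is a regular conditional distribution of $\rho$ given $\mathcal{G}$. Then $\mathcal{G}$ is conditionally trivial under $\rho$ if and only if there exists an iterated regular conditional distribution $\rho^{\mathcal{G}}_2:X\times X\to\mathcal{P}$ of $\rho$ given $\mathcal{G}$ which is $(\mathcal{G}\otimes\mathcal{G},\mathfrak{K})$-measurable.
   Context: $(X,\Sigma)$ is countably generated means that $\Sigma$ is generated by a countable collection of subsets of $X$. $\mathcal{P}$ denotes the set of probability measures on $(X,\Sigma)$, equipped with the $\sigma$-algebra $\mathfrak{K}:=\sigma(\mu\mapsto\mu(A):A\in\Sigma)$, i.e. the smallest $\sigma$-algebra making all evaluation maps $\mu\mapsto\mu(A)$, $A\in\Sigma$, measurable. For $\mu\in\mathcal{P}$ and a sub-$\sigma$-algebra $\mathcal{G}$ of $\Sigma$: - $\mathcal{G}$ is $\mu$-trivial if $\mu(G)\in\{0,1\}$ for all $G\in\mathcal{G}$. - A regular conditional distribution (rcd) of $\mu$ given $\mathcal{G}$ is a $(\mathcal{G},\mathfrak{K})$-measurable function $\mu^{\mathcal{G}}:X\to\mathcal{P}$ such that for all $A\in\Sigma$ and $G\in\mathcal{G}$, $\mu(A\cap G)=\int_G\mu^{\mathcal{G}}(x)(A)\,\mu(dx)$. Given the rcd $\rho^{\mathcal{G}}$ of $\rho$ given $\mathcal{G}$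 (whose existence is a standing assumption): - $\mathcal{G}$ is conditionally trivial under $\rho$ if $\mathcal{G}$ is $\rho^{\mathcal{G}}(x)$-trivial for $\rho$-almost all $x\in X$. - An iterated rcd of $\rho$ given $\mathcal{G}$ is a function $\rho^{\mathcal{G}}_2:X\times X\to\mathcal{P}$ such that for $\rho$-almost every $x\in X$, the map $y\mapsto\rho^{\mathcal{G}}_2(x,y)$ is a rcd of the probability measure $\rho^{\mathcal{G}}(x)$ given $\mathcal{G}$. As usual, ''for $\rho$-almost all $x$'' means for all $x$ outside some $\rho$-null set. $\mathcal{G}\otimes\mathcal{G}$ is the product $\sigma$-algebra on $X\times X$. *)

(* Defs.v *)
From mathcomp Require Import all_boot all_order all_algebra.
From mathcomp Require Import boolp classical_sets cardinality reals ereal.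
From mathcomp Require Import measure lebesgue_integral.

Set Implicit Arguments.
Unset Strict Implicit.
Unset Printing Implicit Defensive.

Local Open Scope classical_set_scope.
Local Open Scope ereal_scope.

Definition countably_generated (d : measure_display) (X : measurableType d) :
    Prop :=
  exists C : set (set X), countable C /\ @measurable d X = <<s C >>.

(* A sub-sigma-algebra is a set system [G] on [X]; [g_sigma_algebraType G] is
   [X] equipped with <<s G >>, which is [G] itself when [G] is a sigma-algebra. *)
Definition is_sub_sigma_algebra (d : measure_display) (X : measurableType d)
    (G : set (set X)) : Prop :=
  sigma_algebra [set: X] G /\ G `<=` measurable.

Definition trivial_under (d : measure_display) (X : measurableType d)
    (R : realType) (mu : probability X R) (G : set (set X)) : Prop :=
  forall B : set X, G B -> mu B = 0 \/ mu B = 1.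

(* [pprobability X R] is [probability X R] with the sigma-algebra generated by
   the sets {mu | mu A < r}, A measurable and r in [0, 1], i.e. by the
   evaluation maps mu |-> mu A. *)
Definition is_rcd (d : measure_display) (X : measurableType d) (R : realType)
    (mu : probability X R) (G : set (set X)) (k : X -> probability X R) :
    Prop :=
  measurable_fun [set: g_sigma_algebraType G]
    (k : g_sigma_algebraType G -> pprobability X R) /\
  forall A B : set X, measurable A -> G B ->
    mu (A `&` B) = \int[mu]_(x in B) k x A.

Definition conditionally_trivial (d : measure_display) (X : measurableType d)
    (R : realType) (rho : probability X R) (G : set (set X))
    (k : X -> probability X R) : Prop :=
  \forall x \ae rho, trivial_under (k x) G.

Definition is_iterated_rcd (d : measure_display) (X : measurableType d)
    (R : realType) (rho : probability X R) (G : set (set X))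
    (k : X -> probability X R) (k2 : X * X -> probability X R) : Prop :=
  \forall x \ae rho, is_rcd (k x) G (fun y => k2 (x, y)).

Definition prod_measurable (d : measure_display) (X : measurableType d)
    (R : realType) (G : set (set X)) (k2 : X * X -> probability X R) : Prop :=
  measurable_fun [set: g_sigma_algebraType G * g_sigma_algebraType G]
    (k2 : g_sigma_algebraType G * g_sigma_algebraType G -> pprobability X R).

(* Main.v *)
Require Import Defs.
From mathcomp Require Import all_boot all_order all_algebra.
From mathcomp Require Import finmap.
From mathcomp Require Import boolp classical_sets cardinality reals ereal.
From mathcomp Require Import functions filter measure measurable_realfun.
From mathcomp Require Import lebesgue_integral kernel.

(** Write [k x] for the conditional distribution of [rho] given [G] at [x].

    If [G] is trivial under almost every [k x], then every event of [G] is
    independent of every event under [k x] ([probability01_setI]).  Hence the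
    constant map [y |-> k x] is a conditional distribution of [k x] given [G],
    and the iterated conditional distribution [(x, y) |-> k x] is jointly
    measurable because it depends on [x] only, through [k].

    The converse rests on the behaviour of [k] along the diagonal.  For a fixed
    [B] in [G], [k x B] is almost surely the indicator of [B] at [x]
    ([rcd_dirac]); so [k x] looks like the Dirac mass at [x] to each single
    event of [G], although the exceptional null set depends on [B].  This passes
    from rectangles to all sets [E] of the product sigma-algebra
    ([rcd_section_dirac]): for almost every [x], [k x] gives the section of [E]
    at [x] mass 1 if [(x, x)] is in [E], and mass 0 otherwise.

    Let [k2] be a jointly measurable iterated conditional distribution, and take
    for [E] the set of those [(x, y)] with [k2 (x, y) = k2 (x, x)].  It contains
    the diagonal, and it belongs to the product sigma-algebra because two
    probabilities are equal as soon as they agree on a countable generating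
    pi-system ([measurable_kernel_eq_diagonal]).  So for almost every [x], the
    map [y |-> k2 (x, y)] is [k x]-almost surely constant.  A conditional
    distribution which is almost surely constant makes [G] independent of
    everything, in particular of itself: [k x B = (k x B) ^ 2] for [B] in [G]
    ([trivial_under_of_ae_constant]). *)

Set Implicit Arguments.
Unset Strict Implicit.
Unset Printing Implicit Defensive.

Import Order.TTheory GRing.Theory Num.Theory.

Local Open Scope classical_set_scope.
Local Open Scope ereal_scope.

(** Finite intersections of a countable generating family are still countable
    in number; stability under intersection is what uniqueness of measures
    asks of a generating family. *)
Lemma countably_generated_setI_closed (d : measure_display)
    (X : measurableType d) :
  countably_generated X ->
  exists C : set (set X), [/\ countable C, C setT, setI_closed C &
    @measurable d X = <<s C >>].
Proof.
move=> [C [cC XC]]; exists (finI_from C id); split.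
- exact: finI_from_countable.
- by exists (@fset0 _) => //; rewrite set_fset0 bigcap_set0.
- by move=> A B; exact: finI_fromI.
rewrite XC; apply/seteqP; split.
  by apply: sub_sigma_algebra2 => A CA; exact: (@finI_from1 _ _ C id).
apply: smallest_sub; first exact: smallest_sigma_algebra.
move=> _ [D DC <-]; rewrite -XC bigcap_fset big_seq.
apply: big_ind => //; first exact: measurableI.
by move=> A /DC; rewrite inE XC => CA; exact: sub_sigma_algebra.
Qed.

Lemma probability_unique (d : measure_display) (X : measurableType d)
    (R : realType) (C : set (set X)) (P Q : probability X R) :
  @measurable d X = <<s C >> -> setI_closed C -> C setT ->
  (forall A, C A -> P A = Q A) -> forall A, measurable A -> P A = Q A.
Proof.
move=> XC IC CT PQ A mA.
apply: (measure_unique C (fun=> setT)) => //.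
- exact: bigcup_const.
- by move=> k; rewrite [ltLHS]probability_setT ltry.
Qed.

(** An event of probability 0 or 1 is independent of every event. *)
Lemma probability01_setI (d : measure_display) (X : measurableType d)
    (R : realType) (P : probability X R) (A B : set X) :
  measurable A -> measurable B -> P B = 0 \/ P B = 1 ->
  P (A `&` B) = P A * P B.
Proof.
move=> mA mB [PB|PB]; rewrite PB ?mule0 ?mule1.
  by apply/eqP; rewrite eq_le measure_ge0 andbT -PB measureIr.
rewrite [RHS](measureDI _ mA mB) [X in _ = X + _](_ : _ = 0) ?add0e//.
apply/eqP; rewrite eq_le measure_ge0 andbT.
rewrite (le_trans (measureIr _ mA (measurableC mB)))//.
by rewrite [leLHS]probability_setC// PB subee.
Qed.

Lemma measurable_fun_evaluation (d d' : measure_display)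
    (T : measurableType d') (X : measurableType d) (R : realType)
    (k : T -> probability X R) (A : set X) :
  measurable_fun setT (k : T -> pprobability X R) -> measurable A ->
  measurable_fun setT (fun t => k t A).
Proof. by move=> mk mA; exact: (measurable_kernel (kprobability mk)). Qed.

Section sub_sigma_algebra.
Context (d : measure_display) (X : measurableType d) (R : realType).
Variable G : set (set X).

(** Two probabilities coincide when they agree on a countable generating
    pi-system, so the condition below amounts to countably many equalities
    between real-valued functions that are measurable for the product
    sigma-algebra. *)
Lemma measurable_kernel_eq_diagonal (k2 : X * X -> probability X R) :
  countably_generated X -> prod_measurable G k2 ->
  measurable ([set p | forall A, measurable A -> k2 p A = k2 (p.1, p.1) A] :
    set (g_sigma_algebraType G * g_sigma_algebraType G)).
Proof.
move=> /countably_generated_setI_closed[C [cC CT IC XC]] mk2.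
have -> : [set p | forall A, measurable A -> k2 p A = k2 (p.1, p.1) A] =
    \bigcap_(A in C) [set p | k2 p A = k2 (p.1, p.1) A].
  apply/seteqP; split => [p kp A CA|p kp].
    by apply: kp; rewrite XC; exact: sub_sigma_algebra.
  exact: probability_unique XC IC CT kp.
have mev A : C A -> measurable_fun
    [set: g_sigma_algebraType G * g_sigma_algebraType G] (fun p => k2 p A).
  move=> CA; apply: measurable_fun_evaluation => //.
  by rewrite XC; exact: sub_sigma_algebra.
have /pfcard_geP[C0|[F]] : (C #<= [set: nat])%card by [].
  by move: CT; rewrite C0.
rewrite (_ : \bigcap_(A in C) _ =
    \bigcap_n [set p | k2 p (F n) = k2 (p.1, p.1) (F n)]); last first.
  apply/seteqP; split => [p kp n _|p kp A CA]; first by apply: kp; exact: funS.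
  by have [n _ <-] := @surj _ _ _ _ F A CA; exact: kp.
apply: bigcapT_measurable => n.
have CF : C (F n) := @funS _ _ _ _ F n I.
rewrite -[X in measurable X]setTI.
apply: measurable_eqe; [exact: measurableT|exact: mev CF|].
apply: (measurableT_comp (mev _ CF)).
by apply: measurable_fun_pair; exact: measurable_fst.
Qed.

Hypothesis subG : is_sub_sigma_algebra G.

Lemma measurable_subE (B : set X) :
  measurable (B : set (g_sigma_algebraType G)) = G B.
Proof. by case: subG => sG _; rewrite -[in RHS](sigma_algebra_id sG). Qed.

Lemma measurable_sub_fun (d' : measure_display) (T : measurableType d')
    (f : X -> T) :
  measurable_fun [set: g_sigma_algebraType G]
    (f : g_sigma_algebraType G -> T) ->
  measurable_fun [set: X] f.
Proof.
move=> mf _ Y mY; have := mf measurableT _ mY.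
by rewrite measurable_subE => /subG.2.
Qed.

Lemma measurable_section (E : set (X * X)) (x : X) :
  measurable (E : set (g_sigma_algebraType G * g_sigma_algebraType G)) ->
  measurable [set y : X | E (x, y)].
Proof.
move=> mE; apply: subG.2; rewrite -measurable_subE.
have := measurable_xsection (x : g_sigma_algebraType G) mE.
by rewrite xsectionE.
Qed.

Lemma measurable_rcd (mu : probability X R) (k : X -> probability X R)
    (A : set X) :
  is_rcd mu G k -> measurable A -> measurable_fun setT (fun x => k x A).
Proof.
move=> kP mA; apply: measurable_sub_fun.
by apply: measurable_fun_evaluation mA; exact: kP.1.
Qed.

(** If the conditional distribution is almost surely constant, the constant is
    the conditioned measure itself, and integrating it over events of [G]
    shows that [G] is independent of every event, hence of itself. *)
Lemma trivial_under_of_ae_constant (mu nu : probability X R)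
    (k : X -> probability X R) :
  is_rcd mu G k ->
  (\forall y \ae mu, forall A, measurable A -> k y A = nu A) ->
  trivial_under mu G.
Proof.
move=> kP knu.
have muI A B : measurable A -> G B -> mu (A `&` B) = nu A * mu B.
  move=> mA GB; have mB := subG.2 _ GB; rewrite kP.2// -integral_cst//.
  apply: ae_eq_integral => //.
    by apply: (@measurable_funS _ _ _ _ setT) => //; exact: measurable_rcd kP mA.
  by apply: filterS knu => y /(_ _ mA) ky _.
move=> B GB; have mB := subG.2 _ GB.
have GT : G setT by rewrite -measurable_subE.
have muB : mu B = nu B.
  by have := muI B setT mB GT; rewrite setIT [mu setT]probability_setT mule1.
have := muI B B mB GB; rewrite setIid -muB -[mu B]fineK ?fin_num_measure//.
move=> -[] /eqP; rewrite -[X in X == _]mulr1 -subr_eq0 -mulrBr mulf_eq0 subr_eq0.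
by move=> /orP[/eqP->|/eqP <-]; [left|right].
Qed.

Section rcd_on_the_diagonal.
Variables (rho : probability X R) (k : X -> probability X R).
Hypothesis kP : is_rcd rho G k.

(** The integral of [k x B] over [C] is [rho (B `&` C)], which vanishes. *)
Lemma rcd_disjoint_null (B C : set X) : G B -> G C -> B `&` C = set0 ->
  \forall x \ae rho, C x -> k x B = 0.
Proof.
move=> GB GC BC0.
have mB := subG.2 _ GB; have mC := subG.2 _ GC.
have mkC : measurable_fun C (fun x => k x B).
  exact: measurable_funS (measurable_rcd kP mB).
have := kP.2 B C mB GC; rewrite BC0 measure0.
rewrite (eq_integral (fun x => `|k x B|)); last first.
  by move=> x _; rewrite gee0_abs.
by move=> /esym/(ae_eq_integral_abs rho mC mkC).
Qed.

Lemma rcd_dirac (B : set X) : G B -> \forall x \ae rho, k x B = dirac x B.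
Proof.
move=> GB; have mB := subG.2 _ GB.
have GBC : G (~` B).
  by rewrite -measurable_subE; apply: measurableC; rewrite measurable_subE.
have k0 := rcd_disjoint_null GB GBC (setICr _).
have k0C := rcd_disjoint_null GBC GB (setICl _).
near=> x; rewrite diracE; case: (boolP (x \in B)) => [|/negP]; rewrite inE => xB.
  rewrite -[B]setCK probability_setC; last exact: measurableC.
  by rewrite (near k0C) ?sube0.
by rewrite (near k0).
Unshelve. all: by end_near. Qed.

(** The sets [E] with this property form a sigma-algebra: complements are
    immediate, and for a union, either some member already carries the whole
    mass or all members have a null section.  Rectangles reduce to
    [rcd_dirac]. *)
Lemma rcd_section_dirac (E : set (X * X)) :
  measurable (E : set (g_sigma_algebraType G * g_sigma_algebraType G)) ->
  \forall x \ae rho, k x [set y | E (x, y)] = dirac x [set z | E (z, z)].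
Proof.
pose S := [set F : set (g_sigma_algebraType G * g_sigma_algebraType G) |
  measurable F /\
  \forall x \ae rho, k x [set y | F (x, y)] = dirac x [set z | F (z, z)]].
have mS F (x : X) : S F -> measurable [set y : X | F (x, y)].
  by move=> [mF _]; exact: measurable_section.
suff : measurable `<=` S by move=> /(_ E)/[apply] -[].
rewrite measurable_prod_measurableType; apply: smallest_sub; first split.
- by split => //; apply: aeW => x /=; rewrite !measure0.
- move=> F SF; split; first by apply: measurableD => //; exact: SF.1.
  have := SF.2; apply: filterS => x; rewrite setTD => kF.
  rewrite (_ : [set y | (~` F) (x, y)] = ~` [set y | F (x, y)])//.
  rewrite probability_setC ?kF; last exact: mS.
  rewrite !diracE; have [Fx|Fx] := pselect (F (x, x)).
    by rewrite (@mem_set _ [set z | F (z, z)] x Fx) memNset// subee.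
  by rewrite (@memNset _ [set z | F (z, z)] x Fx) mem_set// sube0.
- move=> F SF; split; first by apply: bigcupT_measurable => n; exact: (SF n).1.
  have : \forall x \ae rho, forall n,
      k x [set y | F n (x, y)] = dirac x [set z | F n (z, z)].
    by apply/ae_foralln => n; exact: (SF n).2.
  apply: filterS => x kF.
  have mF : measurable (\bigcup_n [set y : X | F n (x, y)]).
    by apply: bigcupT_measurable => n; exact: mS.
  have -> : [set y | (\bigcup_n F n) (x, y)] = \bigcup_n [set y | F n (x, y)].
    by [].
  rewrite diracE; have [[n _ Fnx]|nF] := pselect ((\bigcup_n F n) (x, x)).
    rewrite mem_set/=; last by exists n.
    apply/eqP; rewrite eq_le probability_le1//=.
    have <- : k x [set y | F n (x, y)] = 1 by rewrite kF diracE mem_set.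
    rewrite le_measure ?inE//; first exact: mS.
    by move=> y Fny; exists n.
  rewrite memNset//=; apply/negligibleP => //.
  apply: negligible_bigcup => n; apply/negligibleP; first exact: mS.
  by rewrite [LHS]kF diracE memNset// => Fnx; apply: nF; exists n.
- move=> _ [A mA [B mB <-]]; split; first exact: measurableX.
  rewrite measurable_subE in mA; rewrite measurable_subE in mB.
  have := rcd_dirac mB; apply: filterS => x kB.
  have [Ax|Ax] := pselect (A x).
    rewrite (_ : [set y | (A `*` B) (x, y)] = B); last first.
      by apply/seteqP; split => [y []|].
    rewrite kB !diracE; have [Bx|Bx] := pselect (B x); first by rewrite !mem_set.
    by rewrite !memNset// => -[].
  rewrite (_ : [set y | (A `*` B) (x, y)] = set0); last first.
    by apply/seteqP; split => [y []|].
  by rewrite measure0 diracE memNset// => -[].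
Qed.

End rcd_on_the_diagonal.
End sub_sigma_algebra.

Theorem theorem8 (R : realType) (d : measure_display) (X : measurableType d)
    (rho : probability X R) (G : set (set X)) (rhoG : X -> probability X R) :
  countably_generated X ->
  is_sub_sigma_algebra G ->
  is_rcd rho G rhoG ->
  conditionally_trivial rho G rhoG <->
  exists rhoG2 : X * X -> probability X R,
    is_iterated_rcd rho G rhoG rhoG2 /\ prod_measurable G rhoG2.
Proof.
move=> gX subG kP; split => [ktriv|[k2 [k2P mk2]]].
  exists (fun p => rhoG p.1); split; last first.
    exact: (measurableT_comp kP.1 measurable_fst).
  apply: filterS ktriv => x triv; split.
    exact: (@measurable_cst _ _ (g_sigma_algebraType G) (pprobability X R)
      setT (rhoG x)).
  move=> A B mA GB; have mB := subG.2 _ GB.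
  rewrite [RHS](integral_cst (rhoG x) mB (rhoG x A)).
  exact: probability01_setI mA mB (triv B GB).
have mE := measurable_kernel_eq_diagonal gX mk2.
have := rcd_section_dirac subG kP mE; move: k2P; apply: filterS2 => x k2x kE.
apply: (trivial_under_of_ae_constant subG (nu := k2 (x, x)) k2x).
have mEx := measurable_section subG x mE.
apply/negligibleP; first exact: measurableC.
(* The section at [x] has full mass since [(x, x)] lies in the set. *)
by rewrite [LHS](probability_setC _ mEx) [X in 1 - X]kE diracE mem_set// subee.
Qed.
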